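(* Let $D$ be the directed $3$-cycle with vertex set $\{1,2,3\}$ and arcs $1\to 2\to 3\to 1$ (so the $D$-game is Rock, Paper, Scissors). Define the greedy strategy $\mathcal{R}_g$ for Rei as follows: for a restriction vector $\mathbf{r}$, if $\operatorname{supp}(\mathbf{r})=\{1,2,3\}$ then $\mathcal{R}_g(\mathbf{r})$ is uniform on $\{1,2,3\}$; if $\operatorname{supp}(\mathbf{r})=\{a,b\}$ with $a\to b$ an arc of $D$, then $\mathcal{R}_g(\mathbf{r})=a$ with probability $2/3$ and $=b$ with probability $1/3$; if $\operatorname{supp}(\mathbf{r})=\{a\}$ then $\mathcal{R}_g(\mathbf{r})=a$ with probability $1$. Then $\mathcal{R}_g$ is an optimal strategy for Rei in the semi-restricted $D$-game, and it is the unique one: every optimal strategy $\mathcal{R}$ for Rei satisfies $\Pr(\mathcal{R}(\mathbf{r})=u)=\Pr(\mathcal{R}_g(\mathbf{r})=u)$ for all restriction vectors $\mathbf{r}$ and all $u\in\{1,2,3\}$. Moreover, $S_D((n,n,n))=\Theta(\sqrt{n})$, i.e. there are constants $c,C>0$ with $c\sqrt{n}\le S_D((n,n,n))\le C\sqrt{n}$ for all $n\ge 1$.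
   Context: A digraph $D$ has a finite vertex set $V(D)$ and a set $E(D)$ of ordered pairs of distinct vertices (arcs, written $u\to v$ or $uv$), with at most one arc between any pair of vertices. $N^+(v)=\{u:vu\in E(D)\}$, $N^-(v)=\{u:uv\in E(D)\}$. A restriction vector is a vector $\mathbf{r}$ of nonnegative integers indexed by $V(D)$; $\operatorname{supp}(\mathbf{r})=\{v:\mathbf{r}_v>0\}$; $\delta_v$ is the indicator vector of $v$. Semi-restricted $D$-game with parameter $\mathbf{r}$: two players, Rei and Norman, play $\sum_u\mathbf{r}_u$ rounds; in each round both simultaneously choose a vertex, Rei being required to choose each $u$ exactly $\mathbf{r}_u$ times overall, Norman unrestricted. A strategy for Norman is a function $\mathcal{N}$ assigning to each restriction vector a random variable with values in $V(D)$; a strategy for Rei is a function $\mathcal{R}$ assigning to each restriction vector $\mathbf{r}$ a random variable with values in $\operatorname{supp}(\mathbf{r})$ (choices in different rounds and of the two players are independent). The score for Norman is defined recursively: it is $0$ if $\mathbf{r}=0$; otherwise, with $x=\mathcal{N}(\mathbf{r})$ and $y=\mathcal{R}(\mathbf{r})$, Norman gains $+1$ if $y\in N^+(x)$, $-1$ if $y\in N^-(x)$, $0$ otherwise, and the game continues from $\mathbf{r}-\delta_y$. $S_D(\mathbf{r};\mathcal{N},\mathcal{R})$ is the expected score, $S_D(\mathbf{r};\mathcal{R})=\max_{\mathcal{N}}S_D(\mathbf{r};\mathcal{N},\mathcal{R})$ and $S_D(\mathbf{r})=\min_{\mathcal{R}}S_D(\mathbf{r};\mathcal{R})$. A strategy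 $\mathcal{R}$ for Rei is optimal if $S_D(\mathbf{r};\mathcal{R})=S_D(\mathbf{r})$ for every restriction vector $\mathbf{r}$. *)

(* Defs.v *)
From mathcomp Require Import all_boot all_order all_algebra.
From mathcomp Require Import boolp classical_sets reals ring.

Set Implicit Arguments.
Unset Strict Implicit.
Unset Printing Implicit Defensive.

Import Order.TTheory GRing.Theory Num.Theory.

Local Open Scope ring_scope.

Record digraph := Digraph {
  vertex :> finType;
  arc : rel vertex;
  arc_irrefl : irreflexive arc;
  arc_asym : forall u v, arc u v -> ~~ arc v u
}.

Definition out_nbr (D : digraph) (v : D) : {set D} := [set u | arc v u].
Definition in_nbr (D : digraph) (v : D) : {set D} := [set u | arc u v].

Definition rvec (D : digraph) : Type := {ffun D -> nat}.

Definition supp (D : digraph) (r : rvec D) : {set D} :=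
  [set v | (0 < r v)%N].

(* r - delta_y; the subtraction only truncates when y is not in supp r, a move
   that has probability 0. *)
Definition rdec (D : digraph) (r : rvec D) (y : D) : rvec D :=
  [ffun v => (r v - (v == y))%N].

Definition rounds (D : digraph) (r : rvec D) : nat := (\sum_v r v)%N.

(* A strategy is given by the law of the vertex chosen at each restriction
   vector: [N r x] is Pr(N(r) = x). *)
Record norman_strategy (R : realType) (D : digraph) := NormanStrategy {
  norman_pr :> rvec D -> D -> R;
  norman_pr_ge0 : forall r x, 0 <= norman_pr r x;
  norman_pr_sum1 : forall r, \sum_x norman_pr r x = 1
}.

(* No random variable takes its values in supp 0, which is empty: at r = 0,
   where the game is over, the support condition makes the mass function
   identically 0, and total mass 1 is required only where supp r is nonempty. *)
Record rei_strategy (R : realType) (D : digraph) := ReiStrategy {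
  rei_pr :> rvec D -> D -> R;
  rei_pr_ge0 : forall r y, 0 <= rei_pr r y;
  rei_pr_supp : forall r y, y \notin supp r -> rei_pr r y = 0;
  rei_pr_sum1 : forall r, supp r != finset.set0 -> \sum_y rei_pr r y = 1
}.

Definition gain (R : realType) (D : digraph) (x y : D) : R :=
  if y \in out_nbr x then 1 else if y \in in_nbr x then -1 else 0.

(* A play lists the pairs (Norman's choice, Rei's choice) round by round. *)
Fixpoint play_score (R : realType) (D : digraph) (s : seq (D * D)) : R :=
  if s is (x, y) :: s' then gain R x y + play_score R s' else 0.

(* The factors are multiplied because the choices of the two players and of
   different rounds are independent. *)
Fixpoint play_pr (R : realType) (D : digraph) (N : norman_strategy R D)
    (Q : rei_strategy R D) (r : rvec D) (s : seq (D * D)) : R :=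
  if s is (x, y) :: s' then N r x * Q r y * play_pr N Q (rdec r y) s' else 1.

Definition expected_score (R : realType) (D : digraph) (r : rvec D)
    (N : norman_strategy R D) (Q : rei_strategy R D) : R :=
  \sum_(s : (rounds r).-tuple (D * D)) play_pr N Q r s * play_score R s.

(* S_D(r; Q) and S_D(r): the expected scores are bounded by [rounds r] in
   absolute value, so [sup] and [inf] are the genuine bounds, hence the max and
   the min, both of which are attained. *)
Definition score_against (R : realType) (D : digraph) (r : rvec D)
    (Q : rei_strategy R D) : R :=
  sup (range (fun N : norman_strategy R D => expected_score r N Q)).

Definition game_value (R : realType) (D : digraph) (r : rvec D) : R :=
  inf (range (fun Q : rei_strategy R D => score_against r Q)).

Definition optimal (R : realType) (D : digraph) (Q : rei_strategy R D) : Prop :=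
  forall r : rvec D, score_against r Q = game_value R r.

(* The vertices 1, 2, 3 are encoded as 0, 1, 2 in 'I_3; [ordS] is the cyclic
   successor and [ord_pred] its inverse. *)
Definition c3_arc : rel 'I_3 := fun u v => v == ordS u.

Lemma c3_arc_irrefl : irreflexive c3_arc.
Proof. by case=> [[|[|[|//]]] ?]. Qed.

Lemma c3_arc_asym (u v : 'I_3) : c3_arc u v -> ~~ c3_arc v u.
Proof. by move=> /eqP ->; case: u => [[|[|[|//]]] ?]. Qed.

Definition C3 : digraph := Digraph c3_arc_irrefl c3_arc_asym.

Definition greedy_pr (R : realType) (r : rvec C3) (u : C3) : R :=
  if supp r == [set: 'I_3]%SET then 1 / 3
  else if supp r == [set u; ordS u]%SET then 2 / 3
  else if supp r == [set ord_pred u; u]%SET then 1 / 3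
  else if supp r == [set u]%SET then 1
  else 0.

Lemma greedy_pr_ge0 (R : realType) (r : rvec C3) (u : C3) :
  0 <= greedy_pr R r u.
Proof. by rewrite /greedy_pr; repeat case: ifP => _ //; rewrite divr_ge0. Qed.

Lemma greedy_pr_supp (R : realType) (r : rvec C3) (u : C3) :
  u \notin supp r -> greedy_pr R r u = 0.
Proof.
rewrite /greedy_pr => uNr.
by do 4![case: eqP => [E|_]; first by move: uNr; rewrite E !inE ?eqxx ?orbT].
Qed.

Lemma greedy_pr_sum1 (R : realType) (r : rvec C3) :
  supp r != finset.set0 -> \sum_u greedy_pr R r u = 1.
Proof.
have eqS (A B : {set 'I_3}) :
    (A == B) = [&& (ord0 \in A) == (ord0 \in B),
                   (lift ord0 ord0 \in A) == (lift ord0 ord0 \in B)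
                 & (ord_max \in A) == (ord_max \in B)].
  apply/eqP/and3P => [->|[/eqP e0 /eqP e1 /eqP e2]]; first by rewrite !eqxx.
  apply/setP => -[[|[|[|//]]] i3].
  - by rewrite (_ : Ordinal i3 = ord0) //; apply/val_inj.
  - by rewrite (_ : Ordinal i3 = lift ord0 ord0) //; apply/val_inj.
  - by rewrite (_ : Ordinal i3 = ord_max) //; apply/val_inj.
have l2 : lift ord0 (lift ord0 ord0) = ord_max :> 'I_3 by apply/val_inj.
rewrite /greedy_pr !big_ord_recl big_ord0 l2 !eqS !finset.in_set0 !finset.in_setT !finset.in_set2
  !finset.in_set1 -!val_eqE /=.
case: (ord0 \in _); case: (lift _ _ \in _); case: (ord_max \in _) => //= _;
  by field.
Qed.

Definition greedy (R : realType) : rei_strategy R C3 :=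
  ReiStrategy (@greedy_pr_ge0 R) (@greedy_pr_supp R) (@greedy_pr_sum1 R).

Definition const_rvec (D : digraph) (n : nat) : rvec D := [ffun=> n].

(* Main.v *)
(** Norman's choice does not influence the restriction vector, so against a fixed
    strategy of Rei he does best by maximising his expected gain in each round
    separately.  Write f(r) for the resulting score against the greedy strategy.
    By induction on the number of rounds,
      f(s + delta_(a+1)) < 1 + f(s + delta_a)   for all s and a,
    and these inequalities say exactly that the mixed move of Norman which
    equalises Rei's options at r has positive weights.  Hence, by complementary
    slackness, a move of Rei that keeps every reply of Norman below f(r) must
    equalise those replies, i.e. be the greedy one: this gives optimality and
    uniqueness at once.

    For the growth rate let t = x + y + z and let u be the sum of the squared
    differences of the coordinates.  Along the uniform walk u + 2t is a martingale
    and u^2 + 8tu + 8t^2 a supermartingale, while t/3 <= f <= t once a coordinate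
    vanishes, when u and t^2 are comparable.  Concavity of the square root gives
    f <= sqrt (2(u + 2t)); for the lower bound, f dominates up to a constant
    (u + 2t)/s - (u^2 + 8tu + 8t^2)/s^3, and s is taken of order sqrt n. *)

Require Import Defs.
From mathcomp Require Import all_boot all_order all_algebra.
From mathcomp Require Import boolp classical_sets reals.
From mathcomp Require Import ring lra zify.

Set Implicit Arguments.
Unset Strict Implicit.
Unset Printing Implicit Defensive.

Import Order.TTheory GRing.Theory Num.Theory.

Local Open Scope ring_scope.

(** * Round-by-round recursion for the expected score *)

Lemma big_tuple_cons_pair (V : nmodType) (S T : finType) (n : nat)
    (F : seq (S * T) -> V) :
  \sum_(s : n.+1.-tuple (S * T)) F s =
  \sum_x \sum_y \sum_(s : n.-tuple (S * T)) F ((x, y) :: s).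
Proof.
rewrite (pair_bigA _ (fun x y => \sum_(s : n.-tuple (S * T)) F ((x, y) :: s))) /=.
rewrite pair_big /=.
rewrite (reindex (fun p : (S * T) * n.-tuple (S * T) => cons_tuple p.1 p.2)) /=.
  by apply: eq_bigr => -[[x y] s] _.
exists (fun s : n.+1.-tuple (S * T) => (thead s, behead_tuple s)).
  by move=> [a s] _; rewrite theadE; congr pair; apply/val_inj.
by move=> s _; rewrite [s in RHS]tuple_eta; apply/val_inj.
Qed.

Section Game.
Variables (R : realType) (D : digraph).
Implicit Types (r : rvec D) (N : norman_strategy R D) (Q : rei_strategy R D).

Lemma rounds_rdec r y : y \in supp r -> rounds r = (rounds (rdec r y)).+1.
Proof.
rewrite inE => ry; rewrite /rounds (bigD1 y) //= [in RHS](bigD1 y) //= ffunE eqxx.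
rewrite -addSn subn1 prednK //; congr addn; apply: eq_bigr => v vy.
by rewrite ffunE (negPf vy) subn0.
Qed.

Lemma rounds_eq0 r : (rounds r == 0%N) = (supp r == finset.set0).
Proof.
rewrite /rounds sum_nat_eq0; apply/forallP/eqP => [r0|s0 v].
  by apply/setP => v; rewrite !inE; move/eqP: (r0 v) => ->.
by move/setP/(_ v): s0; rewrite !inE lt0n => /negbFE.
Qed.

Lemma rei_outside Q r y : y \notin supp r -> Q r y = 0.
Proof. exact: rei_pr_supp. Qed.

Lemma rei_sum_supp Q r (F : D -> R) :
  \sum_y Q r y * F y = \sum_(y in supp r) Q r y * F y.
Proof.
rewrite [RHS]big_mkcond; apply: eq_bigr => y _.
by case: ifPn => // /rei_outside ->; rewrite mul0r.
Qed.

(** The length condition keeps the restriction vector nonzero before each of the [n] rounds, so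
    Rei's law has mass 1 every time it is used. *)
Lemma play_pr_sum1 N Q r n : rounds r = n ->
  \sum_(s : n.-tuple (D * D)) play_pr N Q r s = 1.
Proof.
elim: n r => [|n IH] r rn.
  by rewrite (big_pred1 [tuple]) // => s; apply/esym/eqP; exact: tuple0.
rewrite (big_tuple_cons_pair _ (play_pr N Q r)) /=.
rewrite -[RHS](norman_pr_sum1 N r); apply: eq_bigr => x _.
have s0 : supp r != finset.set0 by rewrite -rounds_eq0 rn.
rewrite -[RHS]mulr1 -(rei_pr_sum1 Q s0) mulr_sumr; apply: eq_bigr => y _.
rewrite -mulr_sumr; have [ys|/rei_outside ->] := boolP (y \in supp r).
  by rewrite IH ?mulr1 //; move: rn; rewrite (rounds_rdec ys) => -[].
by rewrite mulr0 mul0r.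
Qed.

Lemma expected_score0 r N Q : rounds r = 0%N -> expected_score r N Q = 0.
Proof.
move=> r0; rewrite /expected_score r0 big1 // => s _.
by rewrite [s]tuple0 /= mulr0.
Qed.

Lemma expected_scoreE r N Q : (0 < rounds r)%N ->
  expected_score r N Q = \sum_x N r x *
    \sum_y Q r y * (gain R x y + expected_score (rdec r y) N Q).
Proof.
case rn: (rounds r) => [//|n] _; rewrite /expected_score rn.
rewrite (big_tuple_cons_pair _ (fun s => play_pr N Q r s * play_score R s)) /=.
apply: eq_bigr => x _; rewrite mulr_sumr; apply: eq_bigr => y _.
have [ys|/rei_outside ->] := boolP (y \in supp r); last first.
  by rewrite mul0r mulr0 big1 // => s _; rewrite !(mulr0, mul0r).
have rn' : rounds (rdec r y) = n by move: rn; rewrite (rounds_rdec ys) => -[].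
(* Once the opening pair is fixed, the remaining plays have total probability 1, so the first gain
   comes out of the sum. *)
under eq_bigr => s _ do rewrite -mulrA mulrDr [_ * gain R x y]mulrC.
rewrite -mulr_sumr big_split /= -mulr_sumr play_pr_sum1 // mulr1.
by rewrite rn' mulrA.
Qed.

(** * Norman's best replies and one-round values *)

Section BestResponse.
Variables (Q : rei_strategy R D) (x0 : D).

Definition payoff r (x : D) : R := \sum_y Q r y * gain R x y.

Definition best_reply r : D := [arg max_(x > x0) payoff r x]%O.

Lemma best_replyP r x : payoff r x <= payoff r (best_reply r).
Proof. by rewrite /best_reply; case: arg_maxP => // z _; apply. Qed.

Definition pure_pr r (x : D) : R := (x == best_reply r)%:R.

Lemma pure_pr_ge0 r x : 0 <= pure_pr r x.
Proof. by rewrite ler0n. Qed.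

Lemma pure_pr_sum1 r : \sum_x pure_pr r x = 1.
Proof.
rewrite (bigD1 (best_reply r)) //= /pure_pr eqxx big1 ?addr0 // => x.
by move/negPf->.
Qed.

Definition best_response : norman_strategy R D :=
  NormanStrategy pure_pr_ge0 pure_pr_sum1.

(** The next restriction vector depends on Rei's move only; hence the continuation contributes the
    same term for every [x], and only [payoff] is left to maximise. *)
Lemma expected_score_best r N :
  expected_score r N Q <= expected_score r best_response Q.
Proof.
have [n] := ubnP (rounds r); elim: n r => // n IH r rn.
have [r0|r0] := posnP (rounds r); first by rewrite !expected_score0.
rewrite !expected_scoreE // [leRHS](bigD1 (best_reply r)) //=.
rewrite [X in _ <= _ + X]big1 ?addr0; last first.
  by move=> x /negPf xr; rewrite /pure_pr xr mul0r.
rewrite /pure_pr eqxx mul1r; set M := leRHS.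
have -> : M = \sum_x N r x * M by rewrite -mulr_suml norman_pr_sum1 mul1r.
apply: ler_sum => x _; apply: ler_wpM2l; first exact: norman_pr_ge0.
under eq_bigr => y _ do rewrite mulrDr.
rewrite {}/M; under [leRHS]eq_bigr => y _ do rewrite mulrDr.
rewrite !big_split /= lerD //; first exact: best_replyP.
rewrite !rei_sum_supp; apply: ler_sum => y ys.
apply: ler_wpM2l; first exact: rei_pr_ge0.
by apply: IH; rewrite -ltnS -rounds_rdec.
Qed.

Lemma score_against_best r :
  score_against r Q = expected_score r best_response Q.
Proof.
apply/eqP; rewrite eq_le; apply/andP; split.
  apply: ge_sup; first by exists (expected_score r best_response Q); exists best_response.
  by move=> _ [N _ <-]; exact: expected_score_best.
apply: ub_le_sup; last by exists best_response.
exists (expected_score r best_response Q) => _ [N _ <-].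
exact: expected_score_best.
Qed.

End BestResponse.

Lemma score_against0 r Q (x0 : D) : rounds r = 0%N -> score_against r Q = 0.
Proof. by move=> r0; rewrite (score_against_best _ x0) expected_score0. Qed.

(** Norman's value for opening with [x] when later play is worth [V]. Leaving [V] free allows a move
    of one strategy to be tested against the score of another. *)
Definition bellman Q (V : rvec D -> R) r (x : D) : R :=
  \sum_y Q r y * (gain R x y + V (rdec r y)).

Lemma bellmanE Q V r x :
  bellman Q V r x = payoff Q r x + \sum_y Q r y * V (rdec r y).
Proof. by rewrite -big_split /=; apply: eq_bigr => y _; rewrite mulrDr. Qed.

Lemma bellman_mono Q V W r x :
  (forall y, y \in supp r -> V (rdec r y) <= W (rdec r y)) ->
  bellman Q V r x <= bellman Q W r x.
Proof.
move=> VW; rewrite /bellman !rei_sum_supp; apply: ler_sum => y ys.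
by apply: ler_wpM2l; [exact: rei_pr_ge0 | rewrite lerD2l VW].
Qed.

Lemma score_against_bellman r Q (x0 : D) : (0 < rounds r)%N ->
  score_against r Q =
  bellman Q (fun r' => score_against r' Q) r (best_reply Q x0 r).
Proof.
move=> r0; rewrite (score_against_best _ x0) expected_scoreE //.
rewrite (bigD1 (best_reply Q x0 r)) //= /pure_pr eqxx mul1r [X in _ + X]big1 ?addr0.
  by rewrite /bellman; apply: eq_bigr => y _; rewrite (score_against_best _ x0).
by move=> x /negPf xr; rewrite xr mul0r.
Qed.

Lemma score_against_ge r Q x : (0 < rounds r)%N ->
  bellman Q (fun r' => score_against r' Q) r x <= score_against r Q.
Proof.
move=> r0; rewrite (score_against_bellman _ x) // !bellmanE lerD2r.
exact: best_replyP.
Qed.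

End Game.

(** * Coordinates on the 3-cycle *)

Definition v0 : C3 := @Ordinal 3 0 isT.
Definition v1 : C3 := @Ordinal 3 1 isT.
Definition v2 : C3 := @Ordinal 3 2 isT.

Variant C3_spec : C3 -> Type :=
  C3_spec0 : C3_spec v0 | C3_spec1 : C3_spec v1 | C3_spec2 : C3_spec v2.

Lemma C3P (u : C3) : C3_spec u.
Proof.
case: u => -[|[|[|//]]] ui.
- by rewrite (_ : Ordinal ui = v0); [constructor | apply/val_inj].
- by rewrite (_ : Ordinal ui = v1); [constructor | apply/val_inj].
- by rewrite (_ : Ordinal ui = v2); [constructor | apply/val_inj].
Qed.

Lemma sum_C3 (V : nmodType) (F : C3 -> V) :
  \sum_(u : C3) F u = F v0 + F v1 + F v2.
Proof.
rewrite !big_ord_recl big_ord0 addr0 addrA.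
by congr (F _ + F _ + F _); apply/val_inj.
Qed.

Definition vec (x y z : nat) : rvec C3 :=
  [ffun u : C3 => nth 0%N [:: x; y; z] (u : 'I_3)].

Lemma vecE (r : rvec C3) : r = vec (r v0) (r v1) (r v2).
Proof. by apply/ffunP => u; rewrite ffunE; case: (C3P u). Qed.

Lemma supp_vec x y z :
  ((v0 \in supp (vec x y z)) = (0 < x)%N) *
  ((v1 \in supp (vec x y z)) = (0 < y)%N) *
  ((v2 \in supp (vec x y z)) = (0 < z)%N).
Proof. by rewrite !inE !ffunE. Qed.

Lemma rdec_vec x y z :
  (rdec (vec x y z) v0 = vec x.-1 y z) *
  (rdec (vec x y z) v1 = vec x y.-1 z) *
  (rdec (vec x y z) v2 = vec x y z.-1).
Proof.
by split; [split|]; apply/ffunP => u; case: (C3P u); rewrite !ffunE /= ?subn1 ?subn0.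
Qed.

Lemma rounds_vec x y z : rounds (vec x y z) = (x + y + z)%N.
Proof. by rewrite /rounds (sum_C3 (vec x y z)) !ffunE. Qed.

Lemma gain_C3 (R : realType) (u v : C3) :
  gain R u v = (v == ordS u :> 'I_3)%:R - (u == ordS v :> 'I_3)%:R.
Proof.
rewrite /gain !inE /= /c3_arc.
by case: (C3P u); case: (C3P v); rewrite -!val_eqE /= ?subr0 ?sub0r ?subrr.
Qed.

Lemma set_C3_eq (A B : {set C3}) : (A == B) =
  [&& (v0 \in A) == (v0 \in B), (v1 \in A) == (v1 \in B)
    & (v2 \in A) == (v2 \in B)].
Proof.
apply/eqP/and3P => [->|[/eqP e0 /eqP e1 /eqP e2]]; first by rewrite !eqxx.
by apply/setP => u; case: (C3P u).
Qed.

(** Greedy probability of a vertex with [a] copies left, where [b] and [c] count its out-neighbour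
    and its in-neighbour. One formula serves all three vertices by rotation. *)
Definition rps_weight (R : realType) (a b c : nat) : R :=
  match a, b, c with
  | 0%N, _, _ => 0
  | _.+1, 0%N, 0%N => 1
  | _.+1, _.+1, 0%N => 2 / 3
  | _.+1, _, _.+1 => 1 / 3
  end.

Lemma greedy_vec (R : realType) (x y z : nat) :
  (greedy R (vec x y z) v0 = rps_weight R x y z) *
  (greedy R (vec x y z) v1 = rps_weight R y z x) *
  (greedy R (vec x y z) v2 = rps_weight R z x y).
Proof.
by split; [split|]; rewrite /= /greedy_pr !set_C3_eq !supp_vec !inE -!val_eqE /=;
  case: x y z => [|x] [|y] [|z].
Qed.

Lemma bellman_C3 (R : realType) (Q : rei_strategy R C3) V x y z :
  let r := vec x y z in
  let c := Q r v0 * V (vec x.-1 y z) + Q r v1 * V (vec x y.-1 z)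
           + Q r v2 * V (vec x y z.-1) in
  (bellman Q V r v0 = Q r v1 - Q r v2 + c) *
  (bellman Q V r v1 = Q r v2 - Q r v0 + c) *
  (bellman Q V r v2 = Q r v0 - Q r v1 + c).
Proof.
rewrite /bellman /=.
by split; [split|]; rewrite sum_C3 !gain_C3 !rdec_vec -!val_eqE /=; ring.
Qed.

(** * The greedy score and its swap inequalities *)

Section Greedy.
Variable R : realType.

Definition gval (x y z : nat) : R := score_against (vec x y z) (greedy R).

Lemma gvalE x y z : gval x y z =
  match x, y, z with
  | 0%N, 0%N, 0%N => 0
  | x'.+1, 0%N, 0%N => 1 + gval x' 0 0
  | 0%N, y'.+1, 0%N => 1 + gval 0 y' 0
  | 0%N, 0%N, z'.+1 => 1 + gval 0 0 z'
  | x'.+1, y'.+1, 0%N => (1 + 2 * gval x' y 0 + gval x y' 0) / 3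
  | 0%N, y'.+1, z'.+1 => (1 + 2 * gval 0 y' z + gval 0 y z') / 3
  | x'.+1, 0%N, z'.+1 => (1 + 2 * gval x 0 z' + gval x' 0 z) / 3
  | x'.+1, y'.+1, z'.+1 => (gval x' y z + gval x y' z + gval x y z') / 3
  end.
Proof.
have [r0|r0] := posnP (rounds (vec x y z)).
  rewrite /gval (score_against0 _ v0) //.
  by move/eqP: r0; rewrite rounds_vec !addn_eq0 => /andP[/andP[/eqP-> /eqP->] /eqP->].
have ub u := score_against_ge (greedy R) u r0.
have := score_against_bellman (greedy R) v0 r0.
(* The score equals one of the three one-round values and bounds them all, so it is their maximum;
   linear arithmetic then identifies it for each support. *)
move: (best_reply _ _ _) (ub v0) (ub v1) (ub v2) => u; move: r0 => _.
rewrite !bellman_C3 !greedy_vec -!/(gval _ _ _).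
by case: (C3P u); rewrite !bellman_C3 !greedy_vec -!/(gval _ _ _);
  case: x y z {ub} => [|x] [|y] [|z] /=; lra.
Qed.

Lemma gval_swap x y z :
  [/\ gval x y.+1 z < 1 + gval x.+1 y z,
      gval x y z.+1 < 1 + gval x y.+1 z
    & gval x.+1 y z < 1 + gval x y z.+1].
Proof.
have [n] := ubnP (x + y + z)%N; elim: n x y z => // n IH x y z xyz.
rewrite (gvalE x.+1 y z) (gvalE x y.+1 z) (gvalE x y z.+1).
move: (IH x.-1 y z) (IH x y.-1 z) (IH x y z.-1) => {IH}.
case: x y z xyz => [|x] [|y] [|z] xyz /= IHx IHy IHz.
(* At a zero coordinate the predecessor truncates and the induction hypothesis does not apply; [try]
   skips it. *)
all: try (case: IHx => [|? ? ?]; first lia).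
all: try (case: IHy => [|? ? ?]; first lia).
all: try (case: IHz => [|? ? ?]; first lia).
all: split; lra.
Qed.

(** * Forced moves, optimality and uniqueness *)

Lemma uniform_of_equalized (p0 p1 p2 f0 f1 f2 : R) :
  p0 + p1 + p2 = 1 -> f0 < 1 + f1 -> f1 < 1 + f2 -> f2 < 1 + f0 ->
  let F := (f0 + f1 + f2) / 3 in
  let c := p0 * f0 + p1 * f1 + p2 * f2 in
  p1 - p2 + c <= F -> p2 - p0 + c <= F -> p0 - p1 + c <= F ->
  [/\ p0 = 1 / 3, p1 = 1 / 3 & p2 = 1 / 3].
Proof.
move=> p1E f01 f12 f20 F c; rewrite -[_ <= F]subr_ge0.
rewrite -[p2 - p0 + c <= F]subr_ge0 -[p0 - p1 + c <= F]subr_ge0.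
set e0 := F - _; set e1 := F - _; set e2 := F - _ => e0_ge0 e1_ge0 e2_ge0.
(* Norman equalises Rei's three options with weights [(1 + f2 - f1) / 3],
   [(1 + f0 - f2) / 3] and [(1 + f1 - f0) / 3]; averaged with them, the slacks
   [e0], [e1], [e2] cancel. *)
have q0_gt0 : 0 < 1 + f2 - f1 by lra.
have q1_gt0 : 0 < 1 + f0 - f2 by lra.
have q2_gt0 : 0 < 1 + f1 - f0 by lra.
have eqE : e0 * (1 + f2 - f1) + e1 * (1 + f0 - f2) + e2 * (1 + f1 - f0) = 0.
  by rewrite /e0 /e1 /e2 /c /F (_ : p2 = 1 - p0 - p1); [field | lra].
have e0q := mulr_ge0 e0_ge0 (ltW q0_gt0).
have e1q := mulr_ge0 e1_ge0 (ltW q1_gt0).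
have e2q := mulr_ge0 e2_ge0 (ltW q2_gt0).
have e00 : e0 = 0 by apply: (mulIf (lt0r_neq0 q0_gt0)); lra.
have e10 : e1 = 0 by apply: (mulIf (lt0r_neq0 q1_gt0)); lra.
have e20 : e2 = 0 by apply: (mulIf (lt0r_neq0 q2_gt0)); lra.
by move: e00 e10 e20; rewrite /e0 /e1 /e2; split; lra.
Qed.

(** Here Rei plays [a] with probability [p] and [b] with probability [q], for an arc from [a] to
    [b]. Norman's reply [a] forces [p >= 2 / 3], and his reply with the third vertex forces
    [p <= 2 / 3]. *)
Lemma two_thirds_of_equalized (p q f g : R) :
  p + q = 1 -> f < 1 + g -> g < 2 + f ->
  let F := (1 + 2 * f + g) / 3 in
  q + (p * f + q * g) <= F -> p - q + (p * f + q * g) <= F ->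
  p = 2 / 3 /\ q = 1 / 3.
Proof.
move=> pq fg gf F h1 h2; have qE : q = 1 - p by lra.
have p_ge : 2 / 3 <= p.
  have : (2 / 3 - p) * (1 + g - f) <= 0 by move: h1; rewrite /F qE; lra.
  by rewrite pmulr_lle0 ?subr_le0 //; lra.
have p_le : p <= 2 / 3.
  have : (p - 2 / 3) * (2 + f - g) <= 0 by move: h2; rewrite /F qE; lra.
  by rewrite pmulr_lle0 ?subr_le0 //; lra.
lra.
Qed.

Local Notation V := (fun r => score_against r (greedy R)).

Lemma greedy_forced (Q : rei_strategy R C3) (r : rvec C3) : (0 < rounds r)%N ->
  (forall x, bellman Q V r x <= V r) -> forall u, Q r u = greedy R r u.
Proof.
rewrite (vecE r); move: (r v0) (r v1) (r v2) => x y z {r} r0 bQ.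
have := rei_pr_sum1 Q (r := vec x y z); rewrite -rounds_eq0 -lt0n => /(_ r0).
rewrite sum_C3.
have out u := rei_outside Q (r := vec x y z) (y := u).
move: (out v0) (out v1) (out v2) => {out}; rewrite !supp_vec -!eqn0Ngt => Q0 Q1 Q2 sQ.
suff : [/\ Q (vec x y z) v0 = rps_weight R x y z,
            Q (vec x y z) v1 = rps_weight R y z x
          & Q (vec x y z) v2 = rps_weight R z x y].
  by move=> [q0 q1 q2] u; case: (C3P u); rewrite greedy_vec.
move: (bQ v0) (bQ v1) (bQ v2); rewrite !bellman_C3 -!/(gval _ _ _) => {bQ}.
rewrite (gvalE x y z).
move: Q0 Q1 Q2 sQ.
move: (Q _ v0) (Q _ v1) (Q _ v2) => p0 p1 p2.
case: x y z r0 => [|x] [|y] [|z] //= _ Q0 Q1 Q2 sQ b0 b1 b2.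
all: rewrite ?(Q0 isT) ?(Q1 isT) ?(Q2 isT) in sQ b0 b1 b2 *.
all: rewrite ?(mul0r, add0r, addr0, subr0, sub0r) in sQ b0 b1 b2 *.
all: try by split.
(* The bound [g < 2 + f] chains two swaps through the vertex outside the support. *)
- have [? ? ?] := gval_swap 0%N y z.
  by have [|||||-> ->] := @two_thirds_of_equalized p1 p2 (gval 0 y z.+1)
    (gval 0 y.+1 z); [lra..|].
- have [? ? ?] := gval_swap x 0%N z.
  by have [|||||-> ->] := @two_thirds_of_equalized p2 p0 (gval x.+1 0 z)
    (gval x 0 z.+1); [lra..|].
- have [? ? ?] := gval_swap x y 0%N.
  by have [|||||-> ->] := @two_thirds_of_equalized p0 p1 (gval x y.+1 0)
    (gval x.+1 y 0); [lra..|].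
(* Each swap is based at the current vector with one copy of two distinct vertices removed. *)
- have [_ _ ?] := gval_swap x y.+1 z.
  have [_ ? _] := gval_swap x.+1 y z.
  have [? _ _] := gval_swap x y z.+1.
  apply: (@uniform_of_equalized p0 p1 p2 (gval x y.+1 z.+1) (gval x.+1 y z.+1)
    (gval x.+1 y.+1 z)) => //.
Qed.

(** By induction the continuations of [Q] are worth at least the greedy ones. If [Q] beat greedy at
    [r], every reply would fall strictly below [V r]; its move would then be greedy, yet some reply
    to the greedy move attains [V r]. *)
Lemma greedy_le (Q : rei_strategy R C3) r : V r <= score_against r Q.
Proof.
have [n] := ubnP (rounds r); elim: n r => // n IH r rn.
have [r0|r0] := posnP (rounds r); first by rewrite !(score_against0 _ v0).
rewrite leNgt; apply/negP => QV.
have bQ x : bellman Q V r x < V r.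
  apply: le_lt_trans QV; apply: le_trans (score_against_ge Q x r0).
  by apply: bellman_mono => y ys; apply: IH; rewrite -ltnS -rounds_rdec.
have Qg := greedy_forced r0 (fun x => ltW (bQ x)).
have := score_against_bellman (greedy R) v0 r0.
set x := best_reply _ _ _ => Ex; move: (bQ x); rewrite Ex.
by rewrite /bellman; under eq_bigr => y _ do rewrite Qg; rewrite ltxx.
Qed.

Lemma game_value_greedy r : game_value R r = V r.
Proof.
have lb : lbound (range (fun Q : rei_strategy R C3 => score_against r Q)) (V r).
  by move=> _ [Q _ <-]; exact: greedy_le.
apply/eqP; rewrite eq_le; apply/andP; split.
  by apply: ge_inf; [exists (V r) | exists (greedy R)].
by apply: lb_le_inf => //; exists (V r); exists (greedy R).
Qed.

Lemma greedy_unique (Q : rei_strategy R C3) : optimal Q ->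
  forall r u, Q r u = greedy R r u.
Proof.
move=> optQ r u; have QV r' : score_against r' Q = V r'.
  by rewrite optQ game_value_greedy.
(* At the zero vector both mass functions vanish identically. *)
have [/eqP|r0] := posnP (rounds r).
  by rewrite rounds_eq0 => /eqP s0; rewrite !rei_outside // s0 inE.
apply: greedy_forced => // x; rewrite -QV.
apply: le_trans (score_against_ge Q x r0).
by apply: bellman_mono => y _; rewrite QV.
Qed.

(** * Square-root growth *)

Definition total (x y z : nat) : R := x%:R + y%:R + z%:R.

Definition spread (x y z : nat) : R :=
  (x%:R - y%:R) ^+ 2 + (y%:R - z%:R) ^+ 2 + (z%:R - x%:R) ^+ 2.

Lemma total_ge0 x y z : 0 <= total x y z.
Proof. by rewrite !addr_ge0 ?ler0n. Qed.

Lemma spread_ge0 x y z : 0 <= spread x y z.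
Proof. by rewrite !addr_ge0 ?sqr_ge0. Qed.

Lemma gval_le_total x y z : gval x y z <= total x y z.
Proof.
have [n] := ubnP (x + y + z)%N; elim: n x y z => // n IH x y z xyz.
rewrite gvalE; move: (IH x.-1 y z) (IH x y.-1 z) (IH x y z.-1) => {IH}.
rewrite /total; case: x y z xyz => [|x] [|y] [|z] xyz /= IHx IHy IHz.
all: try (have {}IHx := IHx ltac:(lia)).
all: try (have {}IHy := IHy ltac:(lia)).
all: try (have {}IHz := IHz ltac:(lia)).
all: lra.
Qed.

(** A round on two vertices is worth 1/3 and a round on one vertex is worth 1; a vanished coordinate
    stays zero. *)
Lemma gval_ge_boundary x y z : [|| x == 0, y == 0 | z == 0]%N ->
  total x y z <= 3 * gval x y z.
Proof.
have [n] := ubnP (x + y + z)%N; elim: n x y z => // n IH x y z xyz.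
rewrite gvalE; move: (IH x.-1 y z) (IH x y.-1 z) (IH x y z.-1) => {IH}.
rewrite /total; case: x y z xyz => [|x] [|y] [|z] xyz //= IHx IHy IHz _.
all: try (have {}IHx := IHx ltac:(lia) ltac:(by rewrite ?orbT)).
all: try (have {}IHy := IHy ltac:(lia) ltac:(by rewrite ?orbT)).
all: try (have {}IHz := IHz ltac:(lia) ltac:(by rewrite ?orbT)).
all: lra.
Qed.

(** The outer factor 2 gives domination of [total] on the boundary, where [2 * spread] is at least
    the square of [total]. *)
Definition envelope (x y z : nat) : R :=
  Num.sqrt (2 * (spread x y z + 2 * total x y z)).

Lemma gval_le_envelope x y z : gval x y z <= envelope x y z.
Proof.
have [n] := ubnP (x + y + z)%N; elim: n x y z => // n IH x y z xyz.
have [xyz0|] := boolP [|| x == 0, y == 0 | z == 0]%N.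
  apply: (@le_trans _ _ (total x y z)); first exact: gval_le_total.
  rewrite -[leLHS]ger0_norm ?total_ge0 // -sqrtr_sqr ler_wsqrtr //.
  have := (sqr_ge0 (x%:R - y%:R : R), sqr_ge0 (y%:R - z%:R : R),
           sqr_ge0 (z%:R - x%:R : R)) => -[[? ?] ?].
  have := (ler0n R x, ler0n R y, ler0n R z) => -[[? ?] ?].
  by rewrite /total /spread; case/or3P: xyz0 => /eqP x0; subst; lra.
case: x y z xyz => [|x] [|y] [|z] xyz // _.
have := (IH x y.+1 z.+1 ltac:(lia), IH x.+1 y z.+1 ltac:(lia), IH x.+1 y.+1 z ltac:(lia)).
rewrite (gvalE x.+1 y.+1 z.+1) => -[[? ?] ?].
have sqE a b c : envelope a b c ^+ 2 = 2 * (spread a b c + 2 * total a b c).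
  by rewrite sqr_sqrtr // mulr_ge0 // addr_ge0 ?spread_ge0 // mulr_ge0 ?total_ge0.
set h := envelope x.+1 y.+1 z.+1; set hx := envelope x y.+1 z.+1.
set hy := envelope x.+1 y z.+1; set hz := envelope x.+1 y.+1 z.
(* The martingale property of [spread + 2 * total]. *)
have hE : hx ^+ 2 + hy ^+ 2 + hz ^+ 2 = 3 * h ^+ 2.
  by rewrite !sqE /spread /total; lra.
have : hx + hy + hz <= 3 * h; last by rewrite /hx /hy /hz; lra.
rewrite -ler_sqr ?nnegrE ?addr_ge0 ?mulr_ge0 ?sqrtr_ge0 //.
have := (sqr_ge0 (hx - hy), sqr_ge0 (hy - hz), sqr_ge0 (hz - hx)) => -[[? ?] ?].
lra.
Qed.

Lemma gval_ge_quartic (s : R) x y z : 1 <= s ->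
  let u := spread x y z in let t := total x y z in
  s ^+ 2 * (u + 2 * t) - (u ^+ 2 + 8 * t * u + 8 * t ^+ 2)
    <= 12 * s ^+ 3 * gval x y z.
Proof.
move=> s1 /=.
have s0 : 0 < s by lra.
have [n] := ubnP (x + y + z)%N; elim: n x y z => // n IH x y z xyz.
have [xyz0|] := boolP [|| x == 0, y == 0 | z == 0]%N.
  have uT : spread x y z <= 2 * total x y z ^+ 2.
    rewrite /total /spread; have := ler0n R x; have := ler0n R y; have := ler0n R z.
    by case/or3P: xyz0 => /eqP-> ? ? ?; nra.
  have := gval_ge_boundary xyz0; have := total_ge0 x y z; have := spread_ge0 x y z.
  move: uT; move: (spread _ _ _) (total _ _ _) (gval _ _ _) => u t g uT u0 t0 tg.
  (* With [t <= 3 * g] this yields the constant 12. For [t <= s] use [u <= 2 * t ^+ 2]; for [s < t]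
     bound [s ^+ 2 * u - u ^+ 2] by [s ^+ 4 / 4]. *)
  have h : s ^+ 2 * (u + 2 * t) - u ^+ 2 <= 4 * s ^+ 3 * t.
    have s3 : s ^+ 2 * t <= s ^+ 3 * t.
      by rewrite ler_wpM2r // exprS ler_peMl // sqr_ge0.
    have [ts|st] := leP t s.
      have : t ^+ 2 * s ^+ 2 <= t * s ^+ 3.
        rewrite -subr_ge0 in ts.
        by have := mulr_ge0 (mulr_ge0 t0 (sqr_ge0 s)) ts; lra.
      have : u * s ^+ 2 <= 2 * t ^+ 2 * s ^+ 2 by rewrite ler_wpM2r ?sqr_ge0.
      nra.
    have : s ^+ 3 * s <= s ^+ 3 * t by rewrite ler_wpM2l ?exprn_ge0 // ltW.
    have := sqr_ge0 (s ^+ 2 - 2 * u); nra.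
  have : s ^+ 3 * t <= s ^+ 3 * (3 * g) by rewrite ler_wpM2l ?exprn_ge0 // ltW.
  have := mulr_ge0 t0 u0; have := sqr_ge0 t; lra.
case: x y z xyz => [|x] [|y] [|z] xyz // _.
have := (IH x y.+1 z.+1 ltac:(lia), IH x.+1 y z.+1 ltac:(lia), IH x.+1 y.+1 z ltac:(lia)).
rewrite (gvalE x.+1 y.+1 z.+1) => -[[]].
(* Over a uniform step the mean of [u ^+ 2 + 8 * t * u + 8 * t ^+ 2] drops by exactly 4. *)
rewrite /spread /total; lra.
Qed.

End Greedy.

Lemma const_rvec_C3 n : const_rvec C3 n = vec n n n.
Proof. by rewrite [LHS]vecE !ffunE. Qed.

Theorem theorem1p1 (R : realType) :
  [/\ optimal (greedy R),
      forall Q : rei_strategy R C3, optimal Q ->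
        forall (r : rvec C3) (u : C3), Q r u = greedy R r u
    & exists c C : R, [/\ 0 < c, 0 < C
        & forall n : nat, (1 <= n)%N ->
            c * Num.sqrt n%:R <= game_value R (const_rvec C3 n) /\
            game_value R (const_rvec C3 n) <= C * Num.sqrt n%:R]].
Proof.
split.
- by move=> r; rewrite game_value_greedy.
- exact: greedy_unique.
(* On the diagonal [envelope] is the square root of [12 * n]. With [q] the square root of [n] and
   [s = 6 * q], the quartic bound reads [144 * q ^+ 4 <= 2592 * q ^+ 3 * gval R n n n], and 2592 /
   144 = 18. *)
exists (1 / 18), (Num.sqrt 12); split; [lra | by rewrite sqrtr_gt0 ltr0n |].
move=> n n1; rewrite game_value_greedy const_rvec_C3 -/(gval R n n n).
have spread_n : spread R n n n = 0 by rewrite /spread; lra.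
have total_n : total R n n n = 3 * n%:R by rewrite /total; lra.
split; last first.
  apply: le_trans (gval_le_envelope R n n n) _.
  by rewrite -sqrtrM ?ler0n // /envelope spread_n total_n ler_wsqrtr //; lra.
set q : R := Num.sqrt n%:R.
have q1 : 1 <= q by rewrite -[1]sqrtr1 ler_wsqrtr // ler1n.
have nE : n%:R = q ^+ 2 by rewrite sqr_sqrtr ?ler0n.
have /(gval_ge_quartic n n n) : 1 <= 6 * q by lra.
rewrite spread_n total_n nE => /= low.
have q3 : 0 < q ^+ 3 by rewrite exprn_gt0 //; lra.
rewrite -(ler_pM2l q3); lra.
Qed.
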